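(* Let $M\subseteq V^L$ be rich, and let $f,g:M\to V$ satisfy $f(m)\le g(m)$ for all $m\in M$. Let $L=J\cup J'\cup J''$ be a disjoint union, let $f$ be insensitive to $J$ and let $g$ be insensitive to $J''$. Then $$f^+(m_{J'})\le g^-(m_{J'})\quad\text{for all } m_{J'}\in M\restriction J',$$ and any $h:M\restriction J'\to V$ (regarded as the function $m\mapsto h(m\restriction J')$ on $M$, which is insensitive to $J\cup J''$) is an interpolant for $f$ and $g$ if and only if $$f^+(m_{J'})\le h(m_{J'})\le g^-(m_{J'})\quad\text{for all } m_{J'}\in M\restriction J'.$$
   Context: $L$ is a set (of propositional variables). $V$ is a finite partially ordered set $(V,\le)$ (of truth values) in which suprema and infima (denoted $\max$ and $\min$) of arbitrary subsets exist. $M\subseteq V^L$ is a set of functions $m:L\to V$ (models). $m\restriction J$, also written $m_J$, is the restriction of $m$ to $J\subseteq L$, and $M\restriction J=\{m\restriction J: m\in M\}$. $M$ is rich if for all $m,m'\in M$ and $J\subseteq L$, the function $(m\restriction J)\cup(m'\restriction(L\setminus J))$ belongs to $M$. $f:M\to V$ is insensitive to $J\subseteq L$ if for all $m,n\in M$, $m\restriction(L\setminus J)=n\restriction(L\setminus J)$ implies $f(m)=f(n)$. $I(f)$ is the set of all $s\in L$ such that $f$ is insensitive to $\{s\}$. For $J'\subseteq L$ and $m_{J'}\in M\restriction J'$: $f^+(m_{J'})=\max\{f(m'): m'\in M,\ m'\restriction J'=m_{J'}\}$ and $f^-(m_{J'})=\min\{f(m'): m'\in M,\ m'\restriction J'=m_{J'}\}$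 (similarly $g^-$). A function $h:M\to V$ is an interpolant for $f$ and $g$ if $f(m)\le h(m)\le g(m)$ for all $m\in M$ and $I(f)\cup I(g)\subseteq I(h)$.
   Formalization: The ''if'' direction is false as stated (L=J'={s}, V={0<1}, M=V^L, f=0, g=1, h(m)=m(s)); it is proved under the added, necessary hypothesis that every s in J' lying in I(f)∪I(g) also lies in I(h). *)

(* Defs.v *)
From mathcomp Require Export all_boot all_order.
From mathcomp Require Export boolp classical_sets functions.

Local Open Scope order_scope.
Local Open Scope classical_set_scope.

Section Interpolation.
(* A finite poset has suprema and infima of all subsets, including the empty
   one, exactly when it is a finite lattice with bottom and top. *)
Context {L : Type} {d : Order.disp_t} {V : finTBLatticeType d}.
Implicit Types (M : set (L -> V)) (A : set V) (J : set L).

Definition max_set A : V := \join_(v in A) v.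
Definition min_set A : V := \meet_(v in A) v.

(* [patch m' J m] agrees with [m] on [J] and with [m'] off [J]. *)
Definition rich M : Prop :=
  forall (m m' : L -> V) J, M m -> M m' -> M (patch m' J m).

(* [sigL J m : J -> V] is the restriction of [m] to [J]. *)
Definition restrictions M J : set (J -> V) := [set sigL J m | m in M].

Definition restriction {M} J (m : M) : restrictions M J :=
  SigSub (mem_set (imageP (sigL J) (set_valP m))).

Definition insensitive {M} (f : M -> V) J : Prop :=
  forall m n : M, sigL (~` J) (val m) = sigL (~` J) (val n) -> f m = f n.

(* The set I(f) of the variables that are individually irrelevant to f. *)
Definition irrelevant {M} (f : M -> V) : set L :=
  [set s | insensitive f [set s]].

Definition fplus {M} (f : M -> V) {J} (u : restrictions M J) : V :=
  max_set [set f m | m in [set m : M | sigL J (val m) = val u]].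

Definition fminus {M} (f : M -> V) {J} (u : restrictions M J) : V :=
  min_set [set f m | m in [set m : M | sigL J (val m) = val u]].

(* A function on restrictions of models, regarded as a function on models. *)
Definition lift_restriction {M J} (h : restrictions M J -> V) : M -> V :=
  fun m => h (restriction J m).

(* The inclusion is a genuine constraint even when h is lifted from the
   restrictions to a set J: the lift is insensitive to the complement of J,
   but a variable of J irrelevant to f or g may still be relevant to h. *)
Definition interpolant {M} (f g h : M -> V) : Prop :=
  (forall m, f m <= h m /\ h m <= g m) /\
  irrelevant f `|` irrelevant g `<=` irrelevant h.

End Interpolation.

(* Main.v *)
Require Import Defs.

Import Order.LTheory.

(** Why the theorem holds.  Let [m] and [n] be models that agree on [J'].  By
    richness, the function [k] that follows [n] on [J] and [m] elsewhere is a
    model.  It differs from [m] on [J] only, and from [n] on [J''] only, because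
    [m] and [n] coincide on [J'].  Hence [f m = f k <= g k = g n], which is
    lemma [glue_le].  Taking the supremum over [m] and the infimum over [n] in
    the class of models restricting to [u] gives [fplus f u <= fminus g u].

    For the lift of [h], the universal properties [fplus_leP] and [le_fminusP]
    turn the bounds [fplus f u <= h u <= fminus g u] into the pointwise
    inequalities [f <= h <= g], since every [u] is the restriction of some model
    and the lift is constant on the models restricting to [u].  As for irrelevant
    variables, a lift from [J'] ignores every variable off [J'], so the
    inclusion demanded of an interpolant only has to be supplied on [J']. *)

Local Open Scope order_scope.
Local Open Scope classical_set_scope.

Section Interpolants.
Context {L : Type} {d : Order.disp_t} {V : finTBLatticeType d} {M : set (L -> V)}.
Implicit Types (f g : M -> V) (J K : set L).

Lemma eq_sigLE J (m n : L -> V) :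
  sigL J m = sigL J n <-> forall x, J x -> m x = n x.
Proof.
split=> [/eq_sigLP mn x Jx | mn]; first exact/mn/mem_set.
by apply/eq_sigLP => x /set_mem /mn.
Qed.

Lemma insensitiveS {f J K} : K `<=` J -> insensitive f J -> insensitive f K.
Proof.
move=> KJ insf m n /eq_sigLE mn; apply: insf.
by apply/eq_sigLE => x nJx; apply: mn => /KJ.
Qed.

Lemma restriction_eqP J (m : M) (u : restrictions M J) :
  sigL J (val m) = val u <-> restriction J m = u.
Proof. by split=> [mu | <-//]; apply: val_inj. Qed.

Lemma fplus_leP f J (u : restrictions M J) v :
  fplus f u <= v <-> forall m, restriction J m = u -> f m <= v.
Proof.
split=> [/joinsP le_v m /restriction_eqP mu | le_v].
  by apply: le_v; apply/mem_set; exists m.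
by apply/joinsP => _ /set_mem[m /restriction_eqP mu <-]; apply: le_v.
Qed.

Lemma le_fminusP f J (u : restrictions M J) v :
  v <= fminus f u <-> forall m, restriction J m = u -> v <= f m.
Proof.
split=> [/meetsP v_le m /restriction_eqP mu | v_le].
  by apply: v_le; apply/mem_set; exists m.
by apply/meetsP => _ /set_mem[m /restriction_eqP mu <-]; apply: v_le.
Qed.

(** The only place where richness enters: two models with the same restriction
    to [J'] can be glued along [J], and [f] and [g] cannot tell the result from
    the first and the second of them, respectively. *)
Lemma glue_le f g J J' J'' (m n : M) :
  rich M -> (forall k, f k <= g k) -> J `|` J' `|` J'' = setT ->
  insensitive f J -> insensitive g J'' ->
  restriction J' m = restriction J' n -> f m <= g n.
Proof.
move=> richM le_fg cover insf insg /restriction_eqP/eq_sigLE mn.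
have Mk : M (patch (val m) J (val n)) by apply: richM; apply: set_valP.
pose k : M := SigSub (mem_set Mk).
have -> : f m = f k.
  apply: insf; apply/eq_sigLE => x nJx /=.
  by rewrite patchN // notin_setE.
suff <- : g k = g n by [].
apply: insg; apply/eq_sigLE => x nJ''x /=.
rewrite /patch; case: ifPn => //; rewrite notin_setE => nJx.
by have : setT x by []; rewrite -cover => -[[//|/mn]|].
Qed.

Lemma insensitive_lift_restriction J K (h : restrictions M J -> V) :
  J `&` K = set0 -> insensitive (lift_restriction h) K.
Proof.
move=> JK0 m n /eq_sigLE mn; congr h; apply/restriction_eqP/eq_sigLE => x Jx.
by apply: mn => Kx; suff : set0 x by []; rewrite -JK0.
Qed.

(** Each restriction comes from a model and the lift of [h] only sees that
    restriction, so an inequality on models is one on restrictions. *)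
Lemma lift_restriction_betweenP f g J (h : restrictions M J -> V) :
  (forall m, f m <= lift_restriction h m /\ lift_restriction h m <= g m) <->
  (forall u, fplus f u <= h u /\ h u <= fminus g u).
Proof.
split=> [fhg u | fhg m].
  by split; [apply/fplus_leP | apply/le_fminusP] => m <-; case: (fhg m).
have [/fplus_leP fh /le_fminusP hg] := fhg (restriction J m).
by split; [apply: fh | apply: hg].
Qed.

End Interpolants.

Theorem proposition1p5p1 (L : Type) (d : Order.disp_t) (V : finTBLatticeType d)
    (M : set (L -> V)) (f g : M -> V) (J J' J'' : set L)
    (richM : rich M) (le_fg : forall m : M, f m <= g m)
    (coverL : J `|` J' `|` J'' = setT) (JJ' : J `&` J' = set0)
    (JJ'' : J `&` J'' = set0) (J'J'' : J' `&` J'' = set0)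
    (insf : insensitive f J) (insg : insensitive g J'') :
  (forall u : restrictions M J', fplus f u <= fminus g u) /\
  (forall h : restrictions M J' -> V,
    [/\ insensitive (lift_restriction h) (J `|` J''),
        interpolant f g (lift_restriction h) ->
          forall u : restrictions M J', fplus f u <= h u /\ h u <= fminus g u
      & J' `&` (irrelevant f `|` irrelevant g)
            `<=` irrelevant (lift_restriction h) ->
          (forall u : restrictions M J',
             fplus f u <= h u /\ h u <= fminus g u) ->
          interpolant f g (lift_restriction h)]).
Proof.
split=> [u | h].
  apply/fplus_leP => m mu; apply/le_fminusP => n nu.
  by apply: (@glue_le _ _ _ _ f g J J' J'') => //; rewrite mu nu.
have insh : insensitive (lift_restriction h) (J `|` J'').
  by apply: insensitive_lift_restriction; rewrite setIUr setIC JJ' set0U.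
split=> // [[fhg _]|irrJ' bounds]; first exact/lift_restriction_betweenP.
split=> [|s irr_s]; first exact/lift_restriction_betweenP.
have : setT s by [].
rewrite -coverL => -[[Js|J's]|J''s].
- by apply: insensitiveS insh => _ ->; left.
- exact: irrJ'.
- by apply: insensitiveS insh => _ ->; right.
Qed.
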